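(* Let $G$ be a $2$-partially walk-regular graph on $n$ vertices with adjacency eigenvalues $\lambda_1\ge\cdots\ge\lambda_n$. Given the spectrum of $G$ (distinct eigenvalues with multiplicities), the value $$\nu_2(G)=\max_{p\in\mathbb R_2[x]}\left(1+\frac{|\{i:p(\lambda_i)<0\}|}{|\{i:p(\lambda_i)>0\}|}\right)\quad\text{subject to}\quad \sum_{i=1}^n p(\lambda_i)=0,$$ where polynomials with $|\{i:p(\lambda_i)>0\}|=0$ are discarded, can be computed in $\mathcal O(n\log n)$ time.
   Context: A graph with adjacency matrix $A$ is $k$-partially walk-regular if for every $\ell=0,\ldots,k$ the diagonal entry $(A^\ell)_{vv}$ is independent of the vertex $v$. $\mathbb R_2[x]$ is the set of real polynomials of degree at most $2$. Eigenvalue counts are with multiplicity. The time for computing the spectrum is not included in the stated running time. *)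

(* Defs.v *)
From HB Require Import structures.
From mathcomp Require Import all_boot all_order all_algebra.
From mathcomp Require Import reals.

Set Implicit Arguments.
Unset Strict Implicit.
Unset Printing Implicit Defensive.

Import Order.TTheory GRing.Theory Num.Theory.
Local Open Scope ring_scope.

Section Graph.
Variables (R : realType) (T : finType) (e : rel T).

Definition adjmx : 'M[R]_#|T| :=
  \matrix_(i, j) (e (enum_val i) (enum_val j))%:R.

Definition partially_walk_regular (k : nat) : Prop :=
  forall l : nat, (l <= k)%N ->
  forall u v : 'I_#|T|, (adjmx ^+ l) u u = (adjmx ^+ l) v v.

Definition adj_eigenvalues (lam : #|T|.-tuple R) : Prop :=
  sorted >=%R lam /\ char_poly adjmx = \prod_(x <- lam) ('X - x%:P).

End Graph.

Section Nu.
Variables (R : realType) (k : nat) (lam : seq R).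

Definition npos (p : {poly R}) : nat := count (fun x => 0 < p.[x]) lam.
Definition nneg (p : {poly R}) : nat := count (fun x => p.[x] < 0) lam.

Definition admissible (p : {poly R}) : Prop :=
  [/\ (size p <= k.+1)%N, \sum_(x <- lam) p.[x] = 0 & (0 < npos p)%N].

Definition objective (p : {poly R}) : R := 1 + (nneg p)%:R / (npos p)%:R.

Definition is_nu (v : R) : Prop :=
  (exists2 p, admissible p & v = objective p) /\
  (forall p, admissible p -> objective p <= v).

End Nu.

(** A real RAM.  

    Structured programs over natural-number variables and arrays (indices,
    counters) and real variables and arrays.  Every arithmetic operation,
    constant, comparison, cast, memory access and control step costs one unit.
    As usual, reals are exact, and there is no rounding and no conversion from
    reals to integers; the only integer operations are addition and truncated
    subtraction.  Division by 0 returns 0, which gives no extra power since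
    equality with 0 can be tested. *)

Inductive iexp : Type :=
| INum of nat
| IVar of nat
| IArr of nat & iexp            (* array name, index *)
| IAdd of iexp & iexp
| ISub of iexp & iexp.

Inductive rexp : Type :=
| RNat of iexp
| RVar of nat
| RArr of nat & iexp
| RAdd of rexp & rexp
| RSub of rexp & rexp
| RMul of rexp & rexp
| RDiv of rexp & rexp.

Inductive bexp : Type :=
| BLtI of iexp & iexp
| BLtR of rexp & rexp
| BNot of bexp
| BAnd of bexp & bexp.

Inductive cmd : Type :=
| Skip
| SetIVar of nat & iexp
| SetIArr of nat & iexp & iexp  (* array name, index, value *)
| SetRVar of nat & rexp
| SetRArr of nat & iexp & rexp
| Seq of cmd & cmd
| If of bexp & cmd & cmd
| While of bexp & cmd.

Fixpoint icost (a : iexp) : nat :=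
  match a with
  | INum _ | IVar _ => 1
  | IArr _ i => (icost i).+1
  | IAdd a b | ISub a b => (icost a + icost b).+1
  end.

Fixpoint rcost (a : rexp) : nat :=
  match a with
  | RVar _ => 1
  | RNat i | RArr _ i => (icost i).+1
  | RAdd a b | RSub a b | RMul a b | RDiv a b => (rcost a + rcost b).+1
  end.

Fixpoint bcost (b : bexp) : nat :=
  match b with
  | BLtI a b => (icost a + icost b).+1
  | BLtR a b => (rcost a + rcost b).+1
  | BNot b => (bcost b).+1
  | BAnd a b => (bcost a + bcost b).+1
  end.

Record state (R : Type) : Type := State {
  ivar : nat -> nat;
  iarr : nat -> nat -> nat;
  rvar : nat -> R;
  rarr : nat -> nat -> R
}.

Definition upd (V : Type) (f : nat -> V) (x : nat) (v : V) : nat -> V :=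
  fun y => if y == x then v else f y.

Section Semantics.
Variable R : realType.
Implicit Types st : state R.

Fixpoint ieval st (a : iexp) : nat :=
  match a with
  | INum c => c
  | IVar x => ivar st x
  | IArr x i => iarr st x (ieval st i)
  | IAdd a b => (ieval st a + ieval st b)%N
  | ISub a b => (ieval st a - ieval st b)%N
  end.

Fixpoint reval st (a : rexp) : R :=
  match a with
  | RNat i => (ieval st i)%:R
  | RVar x => rvar st x
  | RArr x i => rarr st x (ieval st i)
  | RAdd a b => reval st a + reval st b
  | RSub a b => reval st a - reval st b
  | RMul a b => reval st a * reval st b
  | RDiv a b => reval st a / reval st b
  end.

Fixpoint beval st (b : bexp) : bool :=
  match b with
  | BLtI a b => (ieval st a < ieval st b)%N
  | BLtR a b => reval st a < reval st b
  | BNot b => ~~ beval st b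
  | BAnd a b => beval st a && beval st b
  end.

Definition set_ivar st (x v : nat) : state R :=
  State (upd (ivar st) x v) (iarr st) (rvar st) (rarr st).

Definition set_iarr st (x i v : nat) : state R :=
  State (ivar st) (upd (iarr st) x (upd (iarr st x) i v))
        (rvar st) (rarr st).

Definition set_rvar st (x : nat) (v : R) : state R :=
  State (ivar st) (iarr st) (upd (rvar st) x v) (rarr st).

Definition set_rarr st (x i : nat) (v : R) : state R :=
  State (ivar st) (iarr st) (rvar st)
        (upd (rarr st) x (upd (rarr st x) i v)).

(** [exec c st st' t]: started in [st], [c] halts in [st'] after time [t]. *)
Inductive exec : cmd -> state R -> state R -> nat -> Prop :=
| ExecSkip st : exec Skip st st 1
| ExecSetIVar st x a :
    exec (SetIVar x a) st (set_ivar st x (ieval st a)) (icost a).+1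
| ExecSetIArr st x i a :
    exec (SetIArr x i a) st (set_iarr st x (ieval st i) (ieval st a))
         (icost i + icost a).+1
| ExecSetRVar st x a :
    exec (SetRVar x a) st (set_rvar st x (reval st a)) (rcost a).+1
| ExecSetRArr st x i a :
    exec (SetRArr x i a) st (set_rarr st x (ieval st i) (reval st a))
         (icost i + rcost a).+1
| ExecSeq c1 c2 st1 st2 st3 t1 t2 :
    exec c1 st1 st2 t1 -> exec c2 st2 st3 t2 ->
    exec (Seq c1 c2) st1 st3 (t1 + t2)
| ExecIf b c1 c2 st st' t :
    exec (if beval st b then c1 else c2) st st' t ->
    exec (If b c1 c2) st st' (bcost b + t).+1
| ExecWhileFalse b c st :
    ~~ beval st b -> exec (While b c) st st (bcost b).+1
| ExecWhileTrue b c st1 st2 st3 t1 t2 :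
    beval st1 b -> exec c st1 st2 t1 -> exec (While b c) st2 st3 t2 ->
    exec (While b c) st1 st3 (bcost b + t1 + t2).+1.

(** Input: the number of pairs in integer variable 0, the first components in
    real array 0, the second components in integer array 0; all other memory is
    zero.  Output: real variable 0. *)
Definition input (s : seq (R * nat)) : state R :=
  State (upd (fun=> 0%N) 0 (size s))
        (upd (fun=> fun=> 0%N) 0 (nth 0%N (unzip2 s)))
        (fun=> 0)
        (upd (fun=> fun=> 0) 0 (nth 0 (unzip1 s))).

Definition output st : R := rvar st 0.

Lemma exec_det c st st1 st2 t1 t2 :
  exec c st st1 t1 -> exec c st st2 t2 -> st1 = st2 /\ t1 = t2.
Proof.
move=> E; elim: E st2 t2 => {c st st1 t1}
  [st|st x a|st x i a|st x a|st x i a|c1 c2 s1 s2 s3 t1 t2 _ IH1 _ IH2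
  |b c1 c2 s s' t _ IH|b c s nb|b c s1 s2 s3 t1 t2 hb _ IH1 _ IH2] st' t' E';
  inversion E'; subst;
  repeat match goal with
    IH : forall _ _, exec ?c ?s _ _ -> _, H : exec ?c ?s _ _ |- _ =>
      case: (IH _ _ H) => ? ?; subst; clear IH
  end; first [by split | exfalso].
all: match goal with
  H : is_true (~~ beval ?s ?b), H' : is_true (beval ?s ?b) |- _ =>
    by rewrite H' in H
end.
Qed.

End Semantics.

(* Main.v *)
(** Since the eigenvalues sum to 0, a quadratic [p] with [\sum p(lambda_i) = 0]
    has the form [a (x^2 - D) + b x], where [D] is the mean of the squared
    eigenvalues.  Up to a positive factor, and apart from [a = 0], it is
    [+-(x^2 - t x - D) = +-x (K x - t)] with key [K x = x - D / x], so the signs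
    at the eigenvalues only depend on how [t] compares with the keys.  Sorting
    the keys and sweeping [t] through them, at each key and between consecutive
    distinct keys, visits all sign patterns with constant-time updates of the
    two counts; the cost is that of the sort.  The case [a = 0] is dominated by
    a [t] below or above all keys.

    That [D > 0] as soon as there is an edge follows from the fact that a
    symmetric matrix with characteristic polynomial ['X^n] is nilpotent, hence
    zero. *)

Require Import Defs.
From HB Require Import structures.
From mathcomp Require Import all_boot all_order all_algebra.
From mathcomp Require Import zify ring lra.
From mathcomp Require Import reals.

Set Implicit Arguments.
Unset Strict Implicit.
Unset Printing Implicit Defensive.

Import Order.TTheory GRing.Theory Num.Theory.
Local Open Scope ring_scope.

(** * Running time of structured programs *)

Fixpoint loopfree (c : cmd) : bool :=
  match c with
  | Seq a b | If _ a b => loopfree a && loopfree b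
  | While _ _ => false
  | _ => true
  end.

(** Only an upper bound is needed, so a conditional is charged for both branches. The value at a
    loop is a dummy: this cost is used for loop-free commands. *)
Fixpoint maxcost (c : cmd) : nat :=
  match c with
  | Skip => 1
  | SetIVar _ a => (icost a).+1
  | SetIArr _ i a => (icost i + icost a).+1
  | SetRVar _ a => (rcost a).+1
  | SetRArr _ i a => (icost i + rcost a).+1
  | Seq a b => maxcost a + maxcost b
  | If b c1 c2 => (bcost b + (maxcost c1 + maxcost c2)).+1
  | While _ _ => 0
  end.

Section Runs.
Variable R : realType.
Implicit Types (st : state R) (Q : state R -> Prop).

Fixpoint sem (c : cmd) st : state R :=
  match c with
  | SetIVar x a => set_ivar st x (ieval st a)
  | SetIArr x i a => set_iarr st x (ieval st i) (ieval st a)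
  | SetRVar x a => set_rvar st x (reval st a)
  | SetRArr x i a => set_rarr st x (ieval st i) (reval st a)
  | Seq a b => sem b (sem a st)
  | If b c1 c2 => if beval st b then sem c1 st else sem c2 st
  | Skip | While _ _ => st
  end.

(** Total correctness with a time budget; nesting [runs] in [Q] treats sequential composition. *)
Definition runs (c : cmd) st (B : nat) Q : Prop :=
  exists st' t, [/\ exec c st st' t, (t <= B)%N & Q st'].

Lemma exec_sem c st : loopfree c ->
  exists2 t, exec c st (sem c st) t & (t <= maxcost c)%N.
Proof.
elim: c st => [|x a|x i a|x a|x i a|a IHa b IHb|b c1 IH1 c2 IH2|//] st /=.
- by move=> _; eexists; first exact: ExecSkip.
- by move=> _; eexists; first exact: ExecSetIVar.
- by move=> _; eexists; first exact: ExecSetIArr.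
- by move=> _; eexists; first exact: ExecSetRVar.
- by move=> _; eexists; first exact: ExecSetRArr.
- case/andP=> /(IHa st)[t1 E1 h1] /(IHb (sem a st))[t2 E2 h2].
  by exists (t1 + t2)%N; [exact: ExecSeq E1 E2 | lia].
- case/andP=> /(IH1 st)[t1 E1 h1] /(IH2 st)[t2 E2 h2].
  case: ifPn => hb.
    by exists (bcost b + t1).+1; [apply: ExecIf; rewrite hb | lia].
  by exists (bcost b + t2).+1; [apply: ExecIf; rewrite (negPf hb) | lia].
Qed.

Lemma runs_sem c st B Q :
  loopfree c -> (maxcost c <= B)%N -> Q (sem c st) -> runs c st B Q.
Proof.
move=> /(exec_sem st)[t E h] hB q; exists (sem c st), t; split=> //.
exact: leq_trans hB.
Qed.

Lemma runs_seq c1 c2 st B1 B2 Q :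
  runs c1 st B1 (fun st' => runs c2 st' B2 Q) ->
  runs (Seq c1 c2) st (B1 + B2) Q.
Proof.
move=> [s1 [t1 [E1 h1 [s2 [t2 [E2 h2 q]]]]]].
by exists s2, (t1 + t2)%N; split=> //; [exact: ExecSeq E1 E2 | lia].
Qed.

Lemma runs_weaken c st B B' Q Q' :
  (B <= B')%N -> (forall st', Q st' -> Q' st') ->
  runs c st B Q -> runs c st B' Q'.
Proof.
move=> hB hQ [s [t [E h q]]]; exists s, t; split=> //; last exact: hQ.
exact: leq_trans hB.
Qed.

(** The index of the invariant bounds the iterations still to come, and the loop may stop earlier.
    Each round pays for body and test; the last failed test is added. *)
Lemma runs_while (I : nat -> state R -> Prop) b c B k st Q :
  I k st ->
  (forall k' st', I k' st' -> beval st' b ->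
     exists2 k1, k' = k1.+1 & runs c st' B (I k1)) ->
  (forall k' st', I k' st' -> ~~ beval st' b -> Q st') ->
  runs (While b c) st (k * (B + bcost b).+1 + (bcost b).+1) Q.
Proof.
move=> I0 hstep hend.
elim/ltn_ind: k st I0 => k IH st Ik.
case hb: (beval st b); last first.
  exists st, (bcost b).+1; split.
  - by apply: ExecWhileFalse; rewrite hb.
  - by lia.
  - by apply: hend Ik _; rewrite hb.
have [k1 -> {k IH Ik} [s1 [t1 [E1 h1 I1]]]] : exists2 k1, k = k1.+1 &
    runs c st B (fun s1 => runs (While b c) s1
      (k1 * (B + bcost b).+1 + (bcost b).+1) Q).
  have [k1 ek [s1 [t1 [E1 h1 I1]]]] := hstep _ _ Ik hb.
  exists k1 => //; exists s1, t1; split=> //.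
  by apply: IH I1; rewrite ek.
have [s2 [t2 [E2 h2 q]]] := I1.
exists s2, (bcost b + t1 + t2).+1; split=> //.
  exact: ExecWhileTrue hb E1 E2.
by rewrite mulSn; lia.
Qed.

End Runs.

(** * Merge sort *)

Local Arguments upd V f x v y /.

Definition slice (V : Type) (f : nat -> V) (i n : nat) : seq V :=
  [seq f k | k <- iota i n].

Section Slice.
Variable V : Type.
Implicit Types f g : nat -> V.

Lemma size_slice f i n : size (slice f i n) = n.
Proof. by rewrite size_map size_iota. Qed.

Lemma sliceS f i n : slice f i n.+1 = f i :: slice f i.+1 n.
Proof. by []. Qed.

Lemma sliceD f i n1 n2 :
  slice f i (n1 + n2) = slice f i n1 ++ slice f (i + n1) n2.
Proof. by rewrite /slice iotaD map_cat. Qed.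

Lemma nth_slice x0 f i n k : (k < n)%N -> nth x0 (slice f i n) k = f (i + k)%N.
Proof. by move=> kn; rewrite (nth_map 0%N) ?size_iota // nth_iota. Qed.

(** Carries tape contents through writes: everything below the write position [b] is unchanged. *)
Lemma eq_slice f g i n b : (forall p, (p < b)%N -> f p = g p) ->
  (i + n <= b)%N -> slice f i n = slice g i n.
Proof.
move=> fg ib; apply/eq_in_map => p; rewrite mem_iota => /andP[_ h].
by apply: fg; exact: leq_trans ib.
Qed.

End Slice.

(* [vM] is the number of items, padded to a power of 2; [vh] the length of the
   sorted runs, which start at [vo] on the tape.  Integer array 1 is an
   append-only tape of item numbers, and real array 1 holds the keys.  The runs
   [vi .. vie) and [vj .. vje) are merged at [vw]. *)
Local Notation vm := 0%N (only parsing).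
Local Notation vk := 1%N (only parsing).
Local Notation vM := 2%N (only parsing).
Local Notation vh := 3%N (only parsing).
Local Notation vo := 4%N (only parsing).
Local Notation vi := 5%N (only parsing).
Local Notation vie := 6%N (only parsing).
Local Notation vj := 7%N (only parsing).
Local Notation vje := 8%N (only parsing).
Local Notation vw := 9%N (only parsing).
Local Notation ve := 10%N (only parsing).

Definition incr (x : nat) : cmd := SetIVar x (IAdd (IVar x) (INum 1)).
Definition ltv (x y : nat) : bexp := BLtI (IVar x) (IVar y).
Definition key (x : nat) : rexp := RArr 1 (IArr 1 (IVar x)).

(** Ties go to the left run, as in [merge]. [BAnd] evaluates both sides, so a key past the end of a
    run may be read; its value is then irrelevant. *)
Definition merge_step : cmd :=
  Seq (If (BAnd (ltv vi vie) (BNot (BAnd (ltv vj vje) (BLtR (key vj) (key vi)))))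
          (Seq (SetIArr 1 (IVar vw) (IArr 1 (IVar vi))) (incr vi))
          (Seq (SetIArr 1 (IVar vw) (IArr 1 (IVar vj))) (incr vj)))
      (incr vw).

Definition merge_runs : cmd :=
  While (BNot (BAnd (BNot (ltv vi vie)) (BNot (ltv vj vje)))) merge_step.

Definition merge_pair : cmd :=
  Seq (Seq (SetIVar vie (IAdd (IVar vi) (IVar vh)))
      (Seq (SetIVar vj (IVar vie))
           (SetIVar vje (IAdd (IVar vj) (IVar vh)))))
 (Seq merge_runs
      (SetIVar vi (IVar vje))).

Definition merge_level : cmd :=
  Seq (Seq (SetIVar vi (IVar vo))
      (Seq (SetIVar ve (IAdd (IVar vo) (IVar vM)))
           (SetIVar vw (IVar ve))))
 (Seq (While (ltv vi ve) merge_pair)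
      (Seq (SetIVar vo (IVar ve))
           (SetIVar vh (IAdd (IVar vh) (IVar vh))))).

Definition merge_sort : cmd :=
  Seq (SetIVar vh (INum 1)) (While (ltv vh vM) merge_level).

Section MergeSort.
Variable R : realType.
Implicit Types st : state R.

(** Integer array 1, the tape, is left out because sorting writes to it. *)
Definition frame (xs : seq nat) st0 st : Prop :=
  [/\ rvar st = rvar st0, rarr st = rarr st0, iarr st 0 = iarr st0 0%N
    & forall x, x \notin xs -> ivar st x = ivar st0 x].

Lemma frame_trans xs st2 st1 st3 :
  frame xs st1 st2 -> frame xs st2 st3 -> frame xs st1 st3.
Proof.
move=> [a1 b1 c1 d1] [a2 b2 c2 d2].
split; [by rewrite a2|by rewrite b2|by rewrite c2|].
by move=> x hx; rewrite d2 ?d1.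
Qed.

Variable K : nat -> R.
Local Notation le := (fun i j : nat => K i <= K j).

Lemma merge_cons2 x a y b : merge le (x :: a) (y :: b) =
  if K x <= K y then x :: merge le a (y :: b) else y :: merge le (x :: a) b.
Proof. by []. Qed.

Lemma merge_nil_r a : merge le a [::] = a. Proof. by case: a. Qed.

(** Here [a] and [b] are the unread rests of the two runs and [d] the output so far. Both runs end
    by [w0], so output never overwrites them. *)
Definition merge_inv st0 (m0 : seq nat) (w0 k : nat) st : Prop :=
  exists a b d : seq nat,
  [/\ k = (size a + size b)%N, d ++ merge le a b = m0,
      [/\ slice (iarr st 1) (ivar st vi) (size a) = a,
          slice (iarr st 1) (ivar st vj) (size b) = b &
          slice (iarr st 1) w0 (size d) = d],
      [/\ (ivar st vi + size a)%N = ivar st vie,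
          (ivar st vj + size b)%N = ivar st vje,
          ivar st vw = (w0 + size d)%N,
          (ivar st vie <= w0)%N & (ivar st vje <= w0)%N] &
      frame [:: vi; vj; vw] st0 st /\
      forall p, (p < w0)%N -> iarr st 1 p = iarr st0 1%N p].

Lemma slice_rcons (T T' : nat -> nat) w (d : seq nat) x :
  slice T w (size d) = d -> T' = upd T (w + size d) x ->
  slice T' w (size (rcons d x)) = rcons d x.
Proof.
move=> hd ->; rewrite size_rcons -addn1 sliceD -cats1.
congr (_ ++ _); last by rewrite /slice /= /upd eqxx.
rewrite -[RHS]hd; apply: (@eq_slice _ _ _ _ _ (w + size d)) => //.
by move=> p hp; rewrite /upd ltn_eqF.
Qed.

Lemma merge_step_inv st0 m0 w0 k st :
  rarr st0 1 = K ->
  merge_inv st0 m0 w0 k st ->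
  beval st (BNot (BAnd (BNot (ltv vi vie)) (BNot (ltv vj vje)))) ->
  exists2 k1, k = k1.+1 & merge_inv st0 m0 w0 k1 (sem merge_step st).
Proof.
move=> hK [a [b [d [hk hm [ha hb hd] [hi hj hw hie hje] [fr lo]]]]] /= hc.
case: (fr) => [f1 f2 f3 f4].
rewrite f2 hK.
set c := (X in if X then _ else _).
(* The branch test [c] picks the run that supplies the head of [merge le a b]; four cases arise
   according to which rests are empty. *)
have [ca|cb] : (exists x a', [/\ a = x :: a', c = true &
        merge le a b = x :: merge le a' b]) \/
    (exists y b', [/\ b = y :: b', c = false & merge le a b = y :: merge le a b']).
- rewrite /c; move: ha hb hi hj hc;
  case: a {hk hm} => [|x a]; case: b => [|y b] ha hb hi hj hc.
  + by move: hi hj hc => /=; lia.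
  + right; exists y, b; split=> //.
    by move: hi => /= hi; have -> : (ivar st 5 < ivar st 6)%N = false by lia.
  + left; exists x, a; rewrite !merge_nil_r; split=> //.
    move: hi hj => /= hi hj.
    have -> : (ivar st 5 < ivar st 6)%N by lia.
    by have -> : (ivar st 7 < ivar st 8)%N = false by lia.
  + move: ha hb; rewrite !sliceS merge_cons2 => -[hx _] [hy _].
    rewrite hx hy ltNge.
    have -> : (ivar st 5 < ivar st 6)%N by move: hi => /=; lia.
    have -> : (ivar st 7 < ivar st 8)%N by move: hj => /=; lia.
    by case: (K x <= K y); [left; exists x, a|right; exists y, b].
- case: ca => x [a' [ea -> em]]; subst a.
  exists (size a' + size b)%N; first by rewrite hk.
  case: ha => hx ha'; move: hi => /= hi.
  exists a', b, (rcons d x); split=> //=.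
  + by rewrite cat_rcons -em.
  + split.
    * rewrite addn1 -[RHS]ha'; apply: (eq_slice (b := w0)); last by lia.
      by move=> p hp /=; rewrite ltn_eqF //; lia.
    * rewrite -[RHS]hb; apply: (eq_slice (b := w0)); last by lia.
      by move=> p hp /=; rewrite ltn_eqF //; lia.
    * by apply: slice_rcons hd _; rewrite hw hx.
  + by rewrite size_rcons; split=> //; lia.
  + split; last by move=> p hp; rewrite ltn_eqF ?lo //; lia.
    split=> //= y hy; rewrite -(f4 y hy).
    by move: hy; rewrite !inE; do ?case: (y == _) => //.
- case: cb => y [b' [eb -> em]]; subst b.
  exists (size a + size b')%N; first by rewrite hk /= addnS.
  case: hb => hy hb'; move: hj => /= hj.
  exists a, b', (rcons d y); split=> //=.
  + by rewrite cat_rcons -em.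
  + split.
    * rewrite -[RHS]ha; apply: (eq_slice (b := w0)); last by lia.
      by move=> p hp /=; rewrite ltn_eqF //; lia.
    * rewrite addn1 -[RHS]hb'; apply: (eq_slice (b := w0)); last by lia.
      by move=> p hp /=; rewrite ltn_eqF //; lia.
    * by apply: slice_rcons hd _; rewrite hw hy.
  + by rewrite size_rcons; split=> //; lia.
  + split; last by move=> p hp; rewrite ltn_eqF ?lo //; lia.
    split=> //= x hx; rewrite -(f4 x hx).
    by move: hx; rewrite !inE; do ?case: (x == _) => //.
Qed.

Definition merge_time (n : nat) : nat :=
  let b := bcost (BNot (BAnd (BNot (ltv vi vie)) (BNot (ltv vj vje)))) in
  (n * (maxcost merge_step + b).+1 + b.+1)%N.

Lemma runs_merge_runs st a b w0 :
  rarr st 1 = K ->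
  slice (iarr st 1) (ivar st vi) (size a) = a ->
  slice (iarr st 1) (ivar st vj) (size b) = b ->
  (ivar st vi + size a)%N = ivar st vie ->
  (ivar st vj + size b)%N = ivar st vje ->
  ivar st vw = w0 -> (ivar st vie <= w0)%N -> (ivar st vje <= w0)%N ->
  runs merge_runs st (merge_time (size a + size b)) (fun st' =>
    [/\ slice (iarr st' 1) w0 (size a + size b) = merge le a b,
        ivar st' vw = (w0 + (size a + size b))%N,
        frame [:: vi; vj; vw] st st' &
        forall p, (p < w0)%N -> iarr st' 1 p = iarr st 1%N p]).
Proof.
move=> hK ha hb hi hj hw hie hje.
apply: (runs_while (I := merge_inv st (merge le a b) w0)).
- by exists a, b, [::]; split=> //; rewrite /= addn0.
- move=> k st' Ik hb'; have [k1 -> I1] := merge_step_inv hK Ik hb'.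
  by exists k1 => //; apply: runs_sem.
- move=> k st' [a' [b' [d [hk hm [ha' hb' hd] [hi' hj' hw' _ _] [fr lo]]]]] /= hc.
  have a0 : a' = [::] by apply: size0nil; lia.
  have b0 : b' = [::] by apply: size0nil; lia.
  move: hm; rewrite a0 b0 /= cats0 => dE; subst d.
  by move: hd hw'; rewrite size_merge size_cat.
Qed.

(** In this and the later time bounds the summands follow the phases of the program, with constants
    rounded up. *)
Definition pair_time (h : nat) : nat := (12 + (merge_time (h + h) + 2))%N.

Lemma runs_merge_pair st h i w0 :
  rarr st 1 = K -> ivar st vh = h -> ivar st vi = i -> ivar st vw = w0 ->
  (i + (h + h) <= w0)%N ->
  runs merge_pair st (pair_time h) (fun st' =>
    [/\ slice (iarr st' 1) w0 (h + h) =
          merge le (slice (iarr st 1) i h) (slice (iarr st 1) (i + h) h),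
        ivar st' vw = (w0 + (h + h))%N, ivar st' vi = (i + (h + h))%N,
        frame [:: vi; vie; vj; vje; vw] st st' &
        forall p, (p < w0)%N -> iarr st' 1 p = iarr st 1%N p]).
Proof.
move=> hK hh hi hw hle.
apply: runs_seq; apply: runs_sem => //; set st1 := sem _ st.
apply: runs_seq.
have sz i' : size (slice (iarr st 1) i' h) = h by rewrite size_slice.
have := @runs_merge_runs st1 (slice (iarr st 1) i h) (slice (iarr st 1) (i + h) h) w0.
rewrite !sz /= hh hi hw !addnA => /(_ hK erefl erefl erefl erefl erefl).
move=> H; apply: runs_weaken (H _ _); [by []| |by lia|by lia].
move=> st2 [s2 w2 fr2 lo2]; apply: (runs_sem (c := SetIVar _ _)) => //=.
case: fr2 => r1 r2 r3 r4; split=> //.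
- by rewrite r4 //= hh hi; lia.
- split=> //= x hx; rewrite -[RHS](_ : ivar st1 x = _); last first.
    by rewrite /=; move: hx; rewrite !inE; do ?case: (x == _) => //.
  rewrite -r4; last by move: hx; rewrite !inE; do ?case: (x == _) => //.
  by move: hx; rewrite !inE; do ?case: (x == _) => //.
Qed.

Lemma key_total : total le. Proof. by move=> x y; exact: le_total. Qed.

Definition sorted_blocks (T : nat -> nat) (o h q : nat) : Prop :=
  forall k, (k < q)%N -> sorted le (slice T (o + k * h) h).

Definition level_time (h q : nat) : nat :=
  (12 + (q * (pair_time h + 3).+1 + 4 + 8))%N.

Lemma runs_merge_level st h q o :
  let M := (q * (h + h))%N in
  rarr st 1 = K -> ivar st vh = h -> ivar st vo = o -> ivar st vM = M ->
  (0 < h)%N -> sorted_blocks (iarr st 1) o h (q + q) ->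
  runs merge_level st (level_time h q) (fun st' =>
    [/\ sorted_blocks (iarr st' 1) (o + M) (h + h) q,
        perm_eq (slice (iarr st' 1) (o + M) M) (slice (iarr st 1) o M),
        ivar st' vo = (o + M)%N, ivar st' vh = (h + h)%N &
        frame [:: vh; vo; vi; vie; vj; vje; vw; ve] st st']).
Proof.
move=> M hK hh ho hM h0 hT.
apply: runs_seq; apply: runs_sem => //; set st1 := sem _ st.
apply: runs_seq.
(* After [r] pairs, reading stands at [o + r * (h + h)] and writing at [o + M + r * (h + h)]. All
   source blocks lie below [o + M], so [hT] still describes the unread ones. *)
apply: (runs_while (I := fun k st' => exists2 r, q = (r + k)%N &
  [/\ ivar st' vi = (o + r * (h + h))%N /\ ivar st' vw = (o + M + r * (h + h))%N,
     sorted_blocks (iarr st' 1) (o + M) (h + h) r,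
     perm_eq (slice (iarr st' 1) (o + M) (r * (h + h))) (slice (iarr st 1) o (r * (h + h))),
     frame [:: vi; vie; vj; vje; vw] st1 st' &
     forall p, (p < o + M)%N -> iarr st' 1 p = iarr st 1%N p])).
- by exists 0%N => //; split=> //=; rewrite !addn0 ?ho ?hM.
- move=> k st2 [r qE [[i2 w2] b2 p2 f2 lo2]] hb.
  have [g1 g2 g3 g4] := f2.
  case: k qE => [|k] qE.
    by move: hb; rewrite /= (g4 ve) //= ho hM i2 /M qE addn0 ltnn.
  exists k => //.
  have hle : (r * (h + h) + (h + h) <= M)%N by rewrite /M qE addnS mulSn mulnDl; lia.
  have := @runs_merge_pair st2 h _ _ _ _ i2 w2.
  rewrite {1}g2 (g4 vh) // => /(_ hK hh).
  move=> H; apply: runs_weaken (H _); [by []| |by lia].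
  move=> st3 [s3 w3 i3 f3 lo3]; exists r.+1; first by rewrite qE addSnnS.
  have below : slice (iarr st3 1) (o + M) (r * (h + h))
             = slice (iarr st2 1) (o + M) (r * (h + h)).
    by apply: eq_slice lo3 _.
  have o1 : slice (iarr st2 1) (o + r * (h + h)) h
          = slice (iarr st 1) (o + (r + r) * h) h.
    rewrite (eq_slice lo2); last by lia.
    by congr (slice _ _ _); rewrite mulnDl mulnDr.
  have o2 : slice (iarr st2 1) (o + r * (h + h) + h) h
          = slice (iarr st 1) (o + (r + r).+1 * h) h.
    rewrite (eq_slice lo2); last by lia.
    by congr (slice _ _ _); rewrite mulSn mulnDl mulnDr; lia.
  split.
  + by rewrite i3 w3 mulSn; split; lia.
  + move=> k'; rewrite ltnS leq_eqVlt => /orP[/eqP ->|hk].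
      rewrite s3 o1 o2; apply: merge_sorted; first exact: key_total.
        by apply: hT; rewrite qE; lia.
      by apply: hT; rewrite qE; lia.
    rewrite (eq_slice lo3); first exact: b2.
    by rewrite -addnA leq_add2l addnC -mulSn leq_mul2r hk orbT.
  + rewrite mulSnr 2!(sliceD _ _ (r * (h + h)) (h + h)) below s3.
    rewrite -(eq_slice (i := o + r * (h + h)) lo2); last by lia.
    by apply: perm_cat => //; rewrite perm_merge sliceD.
  + exact: frame_trans f2 f3.
  + by move=> p hp; rewrite lo3 ?lo2 //; lia.
- move=> k st2 [r qE [[i2 w2] b2 p2 f2 lo2]] hb.
  have [g1 g2 g3 g4] := f2.
  have k0 : k = 0%N.
    move: hb; rewrite /= (g4 ve) //= ho hM i2 /M qE ltn_add2l -leqNgt leq_mul2r.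
    by case/orP; [move/eqP; lia | lia].
  move: qE; rewrite k0 addn0 => qE; subst r.
  apply: runs_sem => //; rewrite /= !(g4 ve, g4 vh) //= ho hM hh; split=> //.
  split=> //= x hx; rewrite -[RHS](_ : ivar st1 x = _); last first.
    by rewrite /=; move: hx; rewrite !inE; do ?case: (x == _) => //.
  rewrite -g4; last first.
    by move: hx; rewrite !inE !negb_or; do ?case: (x == _) => //=.
  by move: hx; rewrite !inE; do ?case: (x == _) => //.
Qed.

Definition sort_time (L : nat) : nat :=
  (2 + (L * (100 * 2 ^ L + 24 + 3).+1 + 4))%N.

(** Each item costs a constant, and the overhead per pair is absorbed because [q <= q * h]. *)
Lemma level_time_le h q : (0 < h)%N -> (level_time h q <= 100 * (q * (h + h)) + 24)%N.
Proof.
move=> h0; have hq : (q <= q * h)%N by rewrite leq_pmulr.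
rewrite /level_time /pair_time /merge_time /=.
by nia.
Qed.

Lemma runs_merge_sort st L :
  rarr st 1 = K -> ivar st vM = (2 ^ L)%N ->
  runs merge_sort st (sort_time L) (fun st' =>
    [/\ sorted le (slice (iarr st' 1) (ivar st' vo) (2 ^ L)),
        perm_eq (slice (iarr st' 1) (ivar st' vo) (2 ^ L))
                (slice (iarr st 1) (ivar st vo) (2 ^ L)) &
        frame [:: vh; vo; vi; vie; vj; vje; vw; ve] st st']).
Proof.
move=> hK hM.
apply: runs_seq; apply: runs_sem => //; set st1 := sem _ st.
(* After [l] levels there are [2 ^ k] sorted blocks of length [2 ^ l]; at the start these are single
   items. *)
apply: (runs_while (I := fun k st' => exists2 l, L = (l + k)%N &
  [/\ ivar st' vh = (2 ^ l)%N,
      sorted_blocks (iarr st' 1) (ivar st' vo) (2 ^ l) (2 ^ k),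
      perm_eq (slice (iarr st' 1) (ivar st' vo) (2 ^ L))
              (slice (iarr st 1) (ivar st vo) (2 ^ L)) &
      frame [:: vh; vo; vi; vie; vj; vje; vw; ve] st1 st'])).
- by exists 0%N.
- move=> k st2 [l LE [h2 b2 p2 f2]] hb.
  have [g1 g2 g3 g4] := f2.
  case: k LE b2 => [|k] LE b2.
    by move: hb; rewrite /= (g4 vM) //= hM h2 LE addn0 ltnn.
  exists k => //.
  have ME : (2 ^ k * (2 ^ l + 2 ^ l) = 2 ^ L)%N.
    by rewrite LE addnn -mul2n -expnS -expnD; congr (_ ^ _)%N; lia.
  have := @runs_merge_level st2 (2 ^ l) (2 ^ k) _ _ h2 erefl.
  rewrite /= ME g2 (g4 vM) //= => /(_ hK hM).
  rewrite expn_gt0 /= addnn -mul2n -expnS => /(_ isT b2).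
  apply: runs_weaken.
    by apply: leq_trans (level_time_le _ _) _; rewrite ?expn_gt0 // ME.
  move=> st3 [b3 p3 o3 h3 f3]; exists l.+1; first by rewrite LE addSnnS.
  split.
  + by rewrite h3 expnS mul2n addnn.
  + by rewrite o3 expnS mul2n -addnn.
  + by rewrite o3; apply: perm_trans p3 p2.
  + exact: frame_trans f2 f3.
- move=> k st2 [l LE [h2 b2 p2 f2]] hb.
  have [g1 g2 g3 g4] := f2.
  have k0 : k = 0%N.
    by move: hb; rewrite /= (g4 vM) //= hM h2 LE ltn_exp2l //; lia.
  move: LE; rewrite k0 addn0 => LE; subst l.
  split=> //.
    by have := b2 0%N; rewrite k0 /= mul0n addn0; apply.
  split=> //= x hx; rewrite g4 //=.
  by move: hx; rewrite !inE; do ?case: (x == _) => //.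
Qed.
End MergeSort.

(** * Threshold polynomials *)

Section Tally.
Variables (R : realType) (V : nmodType).

(** Indices past the end of [s] read multiplicity 0, so padding to [M] items changes no sum over the
    spectrum. *)
Lemma big_tally (F : R -> V) (s : seq (R * nat)) (lam : seq R) (M : nat) :
  perm_eq (tally_seq s) lam -> (size s <= M)%N ->
  \sum_(x <- lam) F x =
  \sum_(i <- iota 0 M) F (nth 0 (unzip1 s) i) *+ nth 0%N (unzip2 s) i.
Proof.
move=> sl sM; rewrite -(perm_big _ sl) /= big_flatten big_map /=.
transitivity (\sum_(b <- s) F b.1 *+ b.2).
  by apply: eq_bigr => b _; rewrite big_nseq iter_addr_0.
rewrite (big_nth (0, 0%N)) -(subnKC sM) iotaD big_cat /=.
rewrite [X in _ = _ + X]big_seq [X in _ = _ + X]big1 ?addr0; last first.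
  move=> i; rewrite mem_iota add0n => /andP[h _].
  by rewrite [nth 0%N _ _]nth_default ?mulr0n // size_map.
rewrite /index_iota subn0 [LHS]big_seq [RHS]big_seq; apply: eq_bigr => i.
rewrite mem_iota add0n => /andP[_ h].
by rewrite (nth_map (0, 0%N)) // (nth_map (0, 0%N)).
Qed.

End Tally.

Lemma natr_count (R : realType) (a : pred R) (l : seq R) :
  (count a l)%:R = \sum_(x <- l) (a x)%:R :> R.
Proof. by rewrite -sum1_count natr_sum big_mkcond; apply: eq_bigr => x _; case: (a x). Qed.

Lemma sub_in_count (T : eqType) (a1 a2 : pred T) (l : seq T) :
  {in l, forall x, a1 x -> a2 x} -> (count a1 l <= count a2 l)%N.
Proof.
move=> h; rewrite -[count a1 l](@eq_in_count _ (predI a1 a2)).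
  by apply: sub_count => x /andP[].
by move=> x /h /=; case: (a1 x) => //= ->.
Qed.

Section Threshold.
Variables (R : realType) (lam : seq R) (D : R).

Definition skey (x : R) : R := x - D / x.

Definition threshold_poly (t : R) : {poly R} := 'X^2 - t *: 'X - D%:P.

Lemma horner_thr_poly t x : (threshold_poly t).[x] = x ^+ 2 - t * x - D.
Proof. by rewrite /threshold_poly !hornerE. Qed.

Lemma threshold_poly_key t x : x != 0 -> (threshold_poly t).[x] = x * (skey x - t).
Proof. by move=> x0; rewrite horner_thr_poly /skey; field. Qed.

Hypothesis D_gt0 : 0 < D.

Lemma threshold_poly_gt0 t x : (0 < (threshold_poly t).[x]) =
  (0 < x) && (t < skey x) || (x < 0) && (skey x < t).
Proof.
have [x0|x0|<-] := ltgtP 0 x.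
- by rewrite threshold_poly_key ?gt_eqF // pmulr_rgt0 // subr_gt0 orbF.
- by rewrite threshold_poly_key ?lt_eqF // nmulr_rgt0 // subr_lt0.
- by rewrite horner_thr_poly mulr0 expr0n /= subr0 add0r oppr_gt0 ltNge ltW.
Qed.

(** At a zero eigenvalue the value is [- D < 0] whatever the threshold, so its key is irrelevant. *)
Lemma threshold_poly_lt0 t x : ((threshold_poly t).[x] < 0) =
  [|| (0 < x) && (skey x < t), (x < 0) && (t < skey x) | x == 0].
Proof.
have [x0|x0|<-] := ltgtP 0 x.
- by rewrite threshold_poly_key ?gt_eqF // pmulr_rlt0 // subr_lt0 !orbF.
- by rewrite threshold_poly_key ?lt_eqF // nmulr_rlt0 // subr_gt0 orbF.
- by rewrite horner_thr_poly mulr0 expr0n /= subr0 add0r oppr_lt0 D_gt0.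
Qed.

Lemma npos_opp p : npos lam (- p) = nneg lam p.
Proof. by apply: eq_count => x /=; rewrite hornerN oppr_gt0. Qed.

Lemma nneg_opp p : nneg lam (- p) = npos lam p.
Proof. by apply: eq_count => x /=; rewrite hornerN oppr_lt0. Qed.

Hypothesis sum_lam : \sum_(x <- lam) x = 0.
Hypothesis sum_sqr : \sum_(x <- lam) x ^+ 2 = (size lam)%:R * D.

(** The linear term drops out, so the constraint on a quadratic ties its constant coefficient to its
    leading one. *)
Lemma sum_quad (c0 c1 c2 : R) :
  \sum_(x <- lam) (c2 * x ^+ 2 + c1 * x + c0) = (size lam)%:R * (c2 * D + c0).
Proof.
rewrite !big_split /= -!mulr_sumr sum_lam sum_sqr big_const_seq count_predT.
by rewrite iter_addr_0 -mulr_natl; ring.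
Qed.

Lemma sum_thr_poly t : \sum_(x <- lam) (threshold_poly t).[x] = 0.
Proof.
rewrite (eq_bigr (fun x => 1 * x ^+ 2 + (- t) * x + (- D))) => [|x _]; last first.
  by rewrite horner_thr_poly; ring.
by rewrite sum_quad; ring.
Qed.

Lemma size_thr_poly t : (size (threshold_poly t) <= 3)%N.
Proof.
apply/leq_sizeP => j hj; rewrite !coefE.
by rewrite !gtn_eqF ?ltn_eqF //; try lia; rewrite mulr0 !subr0.
Qed.

Definition attained (v : R) : Prop :=
  exists2 p, admissible 2 lam p & v = objective lam p.

(** Without positive values the quotient is a division by 0, so a discarded polynomial has objective
    1. *)
Lemma objective_attained (p : {poly R}) :
  (size p <= 3)%N -> \sum_(x <- lam) p.[x] = 0 ->
  objective lam p = 1 \/ attained (objective lam p).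
Proof.
move=> sp Sp; have [n0|n0] := posnP (npos lam p).
  by left; rewrite /objective n0 invr0 mulr0 addr0.
by right; exists p.
Qed.

Lemma threshold_poly_attained t :
  objective lam (threshold_poly t) = 1 \/ attained (objective lam (threshold_poly t)).
Proof. by apply: objective_attained; [exact: size_thr_poly | exact: sum_thr_poly]. Qed.

Lemma threshold_polyN_attained t :
  objective lam (- threshold_poly t) = 1 \/ attained (objective lam (- threshold_poly t)).
Proof.
apply: objective_attained; first by rewrite size_polyN size_thr_poly.
by under eq_bigr do rewrite hornerN; rewrite sumrN sum_thr_poly oppr0.
Qed.

(** Nonpositive numbers with sum 0 all vanish. *)
Lemma sum0_npos0 (p : {poly R}) : \sum_(x <- lam) p.[x] = 0 -> npos lam p = 0%N ->
  {in lam, forall x, p.[x] = 0}.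
Proof.
move=> Sp /eqP; rewrite -leqn0 leqNgt -has_count => /hasPn np x xl.
have := Sp; rewrite -[X in _ = X -> _]oppr0 => /eqP; rewrite -eqr_oppLR -sumrN.
rewrite big_seq psumr_eq0; last by move=> y yl; rewrite oppr_ge0 leNgt np.
by move=> /allP /(_ x xl); rewrite xl oppr_eq0 => /eqP.
Qed.

Hypothesis lam_neq0 : (0 < size lam)%N.

(** The eigenvalues sum to 0 and are not all 0, since their squares have a positive sum; hence both
    signs occur. This shows that the default value 1 is never the maximum. *)
Lemma X_attained : admissible 2 lam 'X /\ 1 < objective lam 'X.
Proof.
have nz (p : {poly R}) : \sum_(x <- lam) p.[x] = 0 -> (forall x, p.[x] = 0 -> x = 0) ->
    (0 < npos lam p)%N.
  move=> Sp px; rewrite lt0n; apply/negP => /eqP /(sum0_npos0 Sp) h.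
  have : \sum_(x <- lam) x ^+ 2 = 0.
    by rewrite big_seq big1 // => x /h /px ->; rewrite expr0n.
  rewrite sum_sqr => /eqP; rewrite mulf_eq0 pnatr_eq0 (gt_eqF D_gt0) orbF.
  by rewrite -leqn0 leqNgt lam_neq0.
have SX : \sum_(x <- lam) ('X : {poly R}).[x] = 0.
  by under eq_bigr do rewrite hornerX.
have p1 : (0 < npos lam 'X)%N by apply: nz => // x; rewrite hornerX.
have n1 : (0 < nneg lam 'X)%N.
  rewrite -npos_opp; apply: nz => [|x].
    by under eq_bigr do rewrite hornerN; rewrite sumrN SX oppr0.
  by rewrite hornerN hornerX => /eqP; rewrite oppr_eq0 => /eqP.
split; first by split; rewrite ?size_polyX.
by rewrite /objective ltrDl divr_gt0 // ltr0n.
Qed.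

Lemma exists_lower_key : exists t, {in lam, forall x, t < skey x}.
Proof.
exists (- (1 + \sum_(x <- lam) `|skey x|)) => x xl.
rewrite ltrNl (le_lt_trans (ler_norm _)) // normrN.
rewrite (big_rem x xl) /= addrCA ltrDl ltr_wpDr //.
by apply: sumr_ge0.
Qed.

Lemma exists_upper_key : exists t, {in lam, forall x, skey x < t}.
Proof.
exists (1 + \sum_(x <- lam) `|skey x|) => x xl.
rewrite (le_lt_trans (ler_norm _)) //.
rewrite (big_rem x xl) /= addrCA ltrDl ltr_wpDr //.
by apply: sumr_ge0.
Qed.

Lemma objective_le p q : npos lam p = npos lam q -> (nneg lam p <= nneg lam q)%N ->
  objective lam p <= objective lam q.
Proof.
by move=> e h; rewrite /objective e lerD2l ler_wpM2r ?invr_ge0 ?ler0n // ler_nat.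
Qed.

(* Linear polynomials are dominated by a threshold below or above all keys,
   because then zero eigenvalues count as negative. *)
Lemma objective_le_bound (v : R) p :
  (forall t, objective lam (threshold_poly t) <= v /\ objective lam (- threshold_poly t) <= v) ->
  admissible 2 lam p -> objective lam p <= v.
Proof.
move=> hv [sp Sp np].
have pE x : p.[x] = p`_2 * x ^+ 2 + p`_1 * x + p`_0.
  rewrite (@horner_coef_wide _ 3) // !big_ord_recl big_ord0 /= /bump /=.
  by rewrite expr0 expr1; ring.
have n0 : (size lam)%:R != 0 :> R by rewrite pnatr_eq0 -lt0n.
have p0 : p`_0 = - (p`_2 * D).
  move: Sp; under eq_bigr do rewrite pE.
  rewrite sum_quad => /eqP; rewrite mulf_eq0 (negPf n0) /= addrC addr_eq0.
  by move/eqP.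
have pq x : p`_2 != 0 -> p.[x] = p`_2 * (threshold_poly (- (p`_1 / p`_2))).[x].
  by move=> c2; rewrite pE horner_thr_poly p0; field.
have [c2|c2|c2] := ltgtP 0 p`_2.
- apply: le_trans (proj1 (hv (- (p`_1 / p`_2)))).
  rewrite le_eqVlt; apply/orP; left; apply/eqP.
  rewrite /objective; congr (1 + _%:R / _%:R); apply: eq_count => x /=.
    by rewrite pq ?gt_eqF // pmulr_rlt0.
  by rewrite pq ?gt_eqF // pmulr_rgt0.
- apply: le_trans (proj2 (hv (- (p`_1 / p`_2)))).
  rewrite le_eqVlt; apply/orP; left; apply/eqP.
  rewrite /objective; congr (1 + _%:R / _%:R); apply: eq_count => x /=.
    by rewrite pq ?lt_eqF // nmulr_rlt0 // hornerN oppr_lt0.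
  by rewrite pq ?lt_eqF // nmulr_rgt0 // hornerN oppr_gt0.
- have px x : p.[x] = p`_1 * x by rewrite pE p0 -c2; ring.
  have [c1|c1|c1] := ltgtP 0 p`_1.
  + have [t ht] := exists_lower_key.
    apply: le_trans (proj1 (hv t)); apply: objective_le.
      apply: eq_in_count => x xl; rewrite threshold_poly_gt0 px pmulr_rgt0 // ht //.
      by rewrite (lt_gtF (ht x xl)) andbT andbF orbF.
    apply: sub_in_count => x xl; rewrite threshold_poly_lt0 px pmulr_rlt0 // => ->.
    by rewrite ht // orbT.
  + have [t ht] := exists_upper_key.
    apply: le_trans (proj1 (hv t)); apply: objective_le.
      apply: eq_in_count => x xl; rewrite threshold_poly_gt0 px nmulr_rgt0 // ht //.
      by rewrite (lt_gtF (ht x xl)) andbT andbF.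
    apply: sub_in_count => x xl; rewrite threshold_poly_lt0 px nmulr_rlt0 // => ->.
    by rewrite ht.
  + move: np; rewrite /npos (@eq_in_count _ _ pred0) ?count_pred0 //.
    by move=> x _ /=; rewrite px -c1 mul0r ltxx.
Qed.

(** The case [v = 1] is excluded because [v] would also bound the objective of ['X]. *)
Lemma is_nu_bound (v : R) :
  v = 1 \/ attained v ->
  (forall t, objective lam (threshold_poly t) <= v /\ objective lam (- threshold_poly t) <= v) ->
  is_nu 2 lam v.
Proof.
move=> hv hle; split; last by move=> p; exact: objective_le_bound.
have [aX oX] := X_attained.
case: hv => // v1; have := objective_le_bound hle aX.
by rewrite v1 leNgt oX.
Qed.

End Threshold.

(** * Counting signs from a cut of the sorted list of keys *)

Section Cut.
Variables (R : realType) (lam : seq R) (D : R).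
Variables (X : nat -> R) (c : nat -> nat) (u : seq nat).
Local Notation K i := (skey D (X i)).

Definition posw (i : nat) : R := if 0 < X i then (c i)%:R else 0.
Definition negw (i : nat) : R := if X i < 0 then (c i)%:R else 0.
Definition zerow (i : nat) : R := if X i == 0 then (c i)%:R else 0.

Definition weight (w : nat -> R) (l : nat) : R := \sum_(i <- take l u) w i.

(* When the items before position [l] have keys below [t], those from [r] on
   have keys above [t], and those in between have key [t], these are the
   numbers of positive and negative values of [threshold_poly D t]. *)
Definition cut_pos (l r : nat) : R :=
  \sum_(i <- u) posw i - weight posw r + weight negw l.
Definition cut_neg (l r : nat) : R :=
  \sum_(i <- u) negw i - weight negw r + weight posw l + \sum_(i <- u) zerow i.

(** The second quotient belongs to the negated polynomial, for which the two counts are swapped. *)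
Definition raise_cut (v : R) (l r : nat) : R :=
  Num.max (Num.max v (1 + cut_neg l r / cut_pos l r))
          (1 + cut_pos l r / cut_neg l r).

Hypothesis lam_u : forall F : R -> R,
  \sum_(x <- lam) F x = \sum_(i <- u) F (X i) *+ c i.
Hypothesis D_gt0 : 0 < D.
Hypothesis sum_lam : \sum_(x <- lam) x = 0.
Hypothesis sum_sqr : \sum_(x <- lam) x ^+ 2 = (size lam)%:R * D.
Hypothesis lam_neq0 : (0 < size lam)%N.

Definition cut_at (t : R) (l r : nat) : Prop :=
  [/\ (l <= r)%N, {in take l u, forall i, K i < t},
      {in drop l (take r u), forall i, K i = t} &
      {in drop r u, forall i, t < K i}].

Lemma cut_split l r : (l <= r)%N -> u = take l u ++ drop l (take r u) ++ drop r u.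
Proof.
move=> lr; rewrite catA -{1}(cat_take_drop r u); congr (_ ++ _).
by rewrite -{1}(cat_take_drop l (take r u)) take_takel.
Qed.

(** Positive values come from negative eigenvalues with key below [t] and positive ones with key
    above [t]; keys equal to [t] give none. *)
Lemma npos_cut t l r : cut_at t l r -> (npos lam (threshold_poly D t))%:R = cut_pos l r.
Proof.
move=> [lr ha hb hd].
rewrite /npos natr_count lam_u /cut_pos /weight.
have -> : take r u = take l u ++ drop l (take r u).
  by rewrite -{1}(cat_take_drop l (take r u)) take_takel.
rewrite {1 2}(cut_split lr) !big_cat /=.
rewrite [X in X + (_ + _) = _](_ : _ = \sum_(i <- take l u) negw i); last first.
  apply: eq_big_seq => i /ha hi; rewrite threshold_poly_gt0 // (lt_gtF hi) hi andbF andbT /negw.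
  by case: (X i < 0); rewrite ?mul0rn.
rewrite [X in _ + (X + _) = _](_ : _ = 0); last first.
  rewrite big_seq big1 // => i /hb hi; rewrite threshold_poly_gt0 // hi ltxx !andbF.
  by rewrite mul0rn.
rewrite [X in _ + (_ + X) = _](_ : _ = \sum_(i <- drop r u) posw i); last first.
  apply: eq_big_seq => i /hd hi; rewrite threshold_poly_gt0 // (lt_gtF hi) hi andbF andbT orbF /posw.
  by case: (0 < X i); rewrite ?mul0rn.
by ring.
Qed.

(** Dual to the positive count, except that zero eigenvalues may sit in any of the three pieces and
    are collected from each. *)
Lemma nneg_cut t l r : cut_at t l r -> (nneg lam (threshold_poly D t))%:R = cut_neg l r.
Proof.
move=> [lr ha hb hd].
rewrite /nneg natr_count lam_u /cut_neg /weight.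
have -> : take r u = take l u ++ drop l (take r u).
  by rewrite -{1}(cat_take_drop l (take r u)) take_takel.
have S (w : nat -> R) : \sum_(i <- u) w i = \sum_(i <- take l u) w i +
    (\sum_(i <- drop l (take r u)) w i + \sum_(i <- drop r u) w i).
  by rewrite {1}(cut_split lr) !big_cat.
rewrite !S !big_cat /=.
rewrite [X in X + (_ + _) = _](_ : _ =
    \sum_(i <- take l u) posw i + \sum_(i <- take l u) zerow i); last first.
  rewrite -big_split; apply: eq_big_seq => i /ha hi.
  rewrite threshold_poly_lt0 // (lt_gtF hi) hi andbF andbT /posw /zerow /=.
  by case: (ltgtP 0 (X i)); rewrite ?mul0rn ?addr0 ?add0r.
rewrite [X in _ + (X + _) = _](_ : _ = \sum_(i <- drop l (take r u)) zerow i); last first.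
  apply: eq_big_seq => i /hb hi; rewrite threshold_poly_lt0 // hi ltxx !andbF /zerow /=.
  by case: (X i == 0); rewrite ?mul0rn.
rewrite [X in _ + (_ + X) = _](_ : _ =
    \sum_(i <- drop r u) negw i + \sum_(i <- drop r u) zerow i); last first.
  rewrite -big_split; apply: eq_big_seq => i /hd hi.
  rewrite threshold_poly_lt0 // (lt_gtF hi) hi andbF andbT /negw /zerow /=.
  by case: (ltgtP 0 (X i)); rewrite ?mul0rn ?addr0 ?add0r.
by ring.
Qed.

(** What the sweep knows at position [l]. At [l = size u] the condition on [t] is void and all
    thresholds are covered. *)
Definition best_upto (l : nat) (v : R) : Prop :=
  (v = 1 \/ attained lam v) /\
  forall t, {in drop l u, forall i, t < K i} ->
    objective lam (threshold_poly D t) <= v /\ objective lam (- threshold_poly D t) <= v.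

Lemma raise_cutE v t l r : cut_at t l r -> raise_cut v l r =
  Num.max (Num.max v (objective lam (threshold_poly D t))) (objective lam (- threshold_poly D t)).
Proof.
move=> h; rewrite /raise_cut /objective npos_opp nneg_opp.
by rewrite (npos_cut h) (nneg_cut h).
Qed.

Lemma raise_cut_ge v l r : v <= raise_cut v l r.
Proof. by rewrite /raise_cut !le_max lexx. Qed.

Lemma raise_cut_attained v t l r : cut_at t l r ->
  v = 1 \/ attained lam v -> raise_cut v l r = 1 \/ attained lam (raise_cut v l r).
Proof.
move=> h hv; rewrite (raise_cutE _ h) /Num.max.
case: ifP => _; first exact: threshold_polyN_attained.
by case: ifP => _ //; exact: threshold_poly_attained.
Qed.

Lemma raise_cut_bound v t l r : cut_at t l r ->
  objective lam (threshold_poly D t) <= raise_cut v l r /\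
  objective lam (- threshold_poly D t) <= raise_cut v l r.
Proof. by move=> h; rewrite (raise_cutE _ h) !le_max !lexx !orbT. Qed.

Lemma exists_below (s : seq nat) : exists t, {in s, forall i, t < K i}.
Proof.
have [t ht] := exists_lower_key [seq X i | i <- s] D.
by exists t => i si; apply: ht; apply: map_f.
Qed.

(** Finitely many reals can be separated from finitely many larger ones; midpoints serve as
    witnesses. *)
Lemma cut_point l : {in take l u & drop l u, forall i j, K i < K j} ->
  exists t, cut_at t l l.
Proof.
have mid (s1 s2 : seq nat) : {in s1 & s2, forall i j, K i < K j} ->
    exists t, {in s1, forall i, K i < t} /\ {in s2, forall i, t < K i}.
  elim: s1 => [|i s1 IH] h.
    by have [t ht] := exists_below s2; exists t.
  have [|t [t1 t2]] := IH; first by move=> a b ha hb; apply: h; rewrite // inE ha orbT.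
  have [hti|hti] := ltP (K i) t.
    by exists t; split=> // a; rewrite inE => /orP[/eqP ->|/t1].
  (* Now [t <= K i], so a threshold above [K i] also exceeds all keys of [s1]. It is lowered to a
     midpoint for each item of [s2]. *)
  have : exists t', K i < t' /\ {in s2, forall j, t' < K j}.
    have hi : {in s2, forall j, K i < K j} by move=> j hj; apply: h; rewrite // inE eqxx.
    elim: (s2) hi => [|j s IHs] hi; first by exists (K i + 1); rewrite ltrDl ltr01.
    have [|t' [a b]] := IHs; first by move=> j' hj'; apply: hi; rewrite inE hj' orbT.
    exists (Num.min t' ((K i + K j) / 2)).
    have ij : K i < K j by apply: hi; rewrite inE eqxx.
    split; first by rewrite lt_min a /= midf_lt.
    move=> j'; rewrite inE => /orP[/eqP ->|/b h']; last by rewrite gt_min h'.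
    by rewrite gt_min midf_lt // orbT.
  case=> t' [a b]; exists t'; split=> // y; rewrite inE => /orP[/eqP -> //|/t1 h'].
  by apply: lt_trans a; apply: lt_le_trans hti.
move=> /mid[t [t1 t2]]; exists t; split=> // i.
by rewrite drop_oversize // size_take; case: ltnP => //; lia.
Qed.

(** All thresholds below every key give the same cut, so one evaluation covers them. *)
Lemma best_upto0 v : v = 1 -> best_upto 0 (raise_cut v 0 0).
Proof.
move=> v1; have cut t : {in u, forall i, t < K i} -> cut_at t 0 0.
  by move=> ht; split; rewrite ?take0 ?drop0.
have [t ht] := exists_below u; split.
  by apply: raise_cut_attained (cut t ht) _; left.
by move=> t'; rewrite drop0 => /cut; exact: raise_cut_bound.
Qed.

(** The thresholds newly covered are [k] itself and those above [k] but below all later keys. The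
    latter share one cut, so two evaluations suffice; thresholds below [k] were covered before. *)
Lemma best_upto_step g j k v : (g <= j)%N ->
  {in take g u, forall i, K i < k} ->
  {in drop g (take j u), forall i, K i = k} ->
  {in drop j u, forall i, k < K i} ->
  best_upto g v -> best_upto j (raise_cut (raise_cut v g j) j j).
Proof.
move=> gj ha hb hd [v1 v2].
have uj : take j u = take g u ++ drop g (take j u).
  by rewrite -{1}(cat_take_drop g (take j u)) take_takel.
have le_k : {in take j u, forall i, K i <= k}.
  by move=> i; rewrite uj mem_cat => /orP[/ha/ltW|/hb ->].
(* A concrete threshold in the gap is needed only to see that the new value is attained. *)
have [t ht] : exists t, cut_at t j j.
  by apply: cut_point => i i' /le_k hi /hd; exact: le_lt_trans.
have c1 : cut_at k g j by [].
split; first by apply: raise_cut_attained ht _; exact: raise_cut_attained c1 _.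
move=> t' ht'; have [tk|tk|tk] := ltgtP t' k.
- have [|a b] := v2 t'.
    move=> i; rewrite -{1}[u](cat_take_drop j) drop_cat; case: ifP => _.
      by rewrite mem_cat => /orP[/hb ->|/ht'].
    by move/mem_drop/ht'.
  by split; (apply: le_trans (raise_cut_ge _ _ _); apply: le_trans (raise_cut_ge _ _ _)).
- apply: raise_cut_bound; split=> //.
    by move=> i /le_k hi; apply: le_lt_trans tk.
  by move=> i; rewrite drop_oversize // size_take; case: ltnP => //; lia.
- rewrite tk; have [a b] := raise_cut_bound v c1.
  by split; (apply: le_trans (raise_cut_ge _ _ _)).
Qed.

Lemma best_upto_is_nu v : best_upto (size u) v -> is_nu 2 lam v.
Proof.
move=> [v1 v2]; apply: (is_nu_bound D_gt0) => //.
by move=> t; apply: v2 => i; rewrite drop_size.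
Qed.

End Cut.

(** * The sweep *)

(* [rposl], [rnegl] and [rposr], [rnegr] hold the weights of the positive and
   negative eigenvalues before the current group of equal keys and up to its
   last item read so far; [rpos], [rneg], [rzero] hold the totals. *)
Local Notation rbest := 0%N (only parsing).
Local Notation rcard := 1%N (only parsing).
Local Notation rsqr := 2%N (only parsing).
Local Notation rD := 3%N (only parsing).
Local Notation rpos := 4%N (only parsing).
Local Notation rneg := 5%N (only parsing).
Local Notation rzero := 6%N (only parsing).
Local Notation rposl := 7%N (only parsing).
Local Notation rnegl := 8%N (only parsing).
Local Notation rposr := 9%N (only parsing).
Local Notation rnegr := 10%N (only parsing).

Definition raise (e : rexp) : cmd := If (BLtR (RVar rbest) e) (SetRVar rbest e) Skip.

Definition pos_exp : rexp := RAdd (RSub (RVar rpos) (RVar rposr)) (RVar rnegl).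
Definition neg_exp : rexp :=
  RAdd (RAdd (RSub (RVar rneg) (RVar rnegr)) (RVar rposl)) (RVar rzero).

(* Division by 0 yields the harmless value 1, a lower bound of the maximum. *)
Definition eval_cut : cmd :=
  Seq (raise (RAdd (RNat (INum 1)) (RDiv neg_exp pos_exp)))
      (raise (RAdd (RNat (INum 1)) (RDiv pos_exp neg_exp))).

Definition add_to (r : nat) (e : rexp) : cmd := SetRVar r (RAdd (RVar r) e).

Definition add_item : cmd :=
  let x := RArr 0 (IArr 1 (IVar vi)) in
  let c := RNat (IArr 0 (IArr 1 (IVar vi))) in
  If (BLtR (RNat (INum 0)) x) (add_to rposr c)
     (If (BLtR x (RNat (INum 0))) (add_to rnegr c) Skip).

(** The first evaluation puts the threshold at the key of the group; after the left weights catch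
    up, the second puts it in the gap above. *)
Definition close_group : cmd :=
  Seq eval_cut
 (Seq (Seq (SetRVar rposl (RVar rposr)) (SetRVar rnegl (RVar rnegr)))
      eval_cut).

(** The keys being sorted, a next key that is not strictly larger is equal and keeps the group
    open. *)
Definition sweep_step : cmd :=
  Seq add_item
 (Seq (incr vi)
      (If (BAnd (ltv vi ve)
                (BNot (BLtR (RArr 1 (IArr 1 (ISub (IVar vi) (INum 1)))) (key vi))))
          Skip close_group)).

Definition sweep : cmd :=
  Seq (Seq (Seq (SetRVar rbest (RNat (INum 1)))
           (Seq (SetIVar vi (IVar vo))
                (SetIVar ve (IAdd (IVar vo) (IVar vM)))))
           eval_cut)
      (While (ltv vi ve) sweep_step).

Section Sweep.
Variables (R : realType) (lam : seq R) (D : R) (u : seq nat) (o : nat) (st0 : state R).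
Implicit Types st : state R.
Local Notation X := (rarr st0 0).
Local Notation c := (iarr st0 0).
Local Notation K i := (skey D (X i)).
Local Notation M := (size u).

Hypothesis keyE : forall i, rarr st0 1 i = K i.
Hypothesis uE : slice (iarr st0 1) o M = u.
Hypothesis u_sorted : sorted (fun i j => rarr st0 1 i <= rarr st0 1 j) u.

Definition sweep_at (g j : nat) st : Prop :=
  [/\ ivar st vi = (o + j)%N /\ ivar st ve = (o + M)%N,
      iarr st = iarr st0 /\ rarr st = rarr st0,
      [/\ rvar st rpos = \sum_(i <- u) posw X c i,
          rvar st rneg = \sum_(i <- u) negw X c i &
          rvar st rzero = \sum_(i <- u) zerow X c i],
      rvar st rposl = weight u (posw X c) g /\ rvar st rnegl = weight u (negw X c) g &
      rvar st rposr = weight u (posw X c) j /\ rvar st rnegr = weight u (negw X c) j].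

Lemma sem_raise e st : let st' := sem (raise e) st in
  [/\ rvar st' 0 = Num.max (rvar st 0) (reval st e),
      forall y, rvar st' y.+1 = rvar st y.+1,
      ivar st' = ivar st, iarr st' = iarr st & rarr st' = rarr st].
Proof. by rewrite /= /Num.max; case: ifP. Qed.

Lemma sem_eval_cut g j st : sweep_at g j st ->
  sweep_at g j (sem eval_cut st) /\
  rvar (sem eval_cut st) 0 = raise_cut X c u (rvar st 0) g j.
Proof.
move=> [[a1 a2] [b1 b2] [c1 c2 c3] [d1 d2] [e1 e2]].
rewrite /eval_cut; set v1 := RAdd _ (RDiv neg_exp _); set v2 := RAdd _ (RDiv pos_exp _).
have [f1 f2 f3 f4 f5] := sem_raise v1 st.
have [g1 g2 g3 g4 g5] := sem_raise v2 (sem (raise v1) st).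
change (sem (Seq _ _) st) with (sem (raise v2) (sem (raise v1) st)).
split.
  by rewrite /sweep_at !g2 !f2 g3 g4 g5 f3 f4 f5.
have pE st' : (forall y, rvar st' y.+1 = rvar st y.+1) ->
    reval st' pos_exp = cut_pos X c u g j.
  by move=> h; rewrite /= !h c1 e1 d2.
have nE st' : (forall y, rvar st' y.+1 = rvar st y.+1) ->
    reval st' neg_exp = cut_neg X c u g j.
  by move=> h; rewrite /= !h c2 e2 d1 c3.
rewrite g1 f1 /raise_cut /v1 /v2; cbn [reval ieval].
by rewrite !pE // !nE.
Qed.

Lemma nth_u k : (k < M)%N -> nth 0%N u k = iarr st0 1 (o + k).
Proof. by move=> kM; rewrite -{1}uE nth_slice. Qed.

Lemma weightS (w : nat -> R) k : (k < M)%N ->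
  weight u w k.+1 = weight u w k + w (iarr st0 1 (o + k)).
Proof.
by move=> kM; rewrite /weight (take_nth 0%N) // -cats1 big_cat big_seq1 nth_u.
Qed.

Lemma sem_add_item g j st : (j < M)%N -> sweep_at g j st ->
  let st' := sem (incr vi) (sem add_item st) in
  sweep_at g j.+1 st' /\ rvar st' 0 = rvar st 0.
Proof.
move=> jM [[a1 a2] [b1 b2] [c1 c2 c3] [d1 d2] [e1 e2]].
rewrite /sweep_at !weightS // /posw /negw.
rewrite /= a1 b1 b2.
have [x0|x0|x0] := ltgtP 0 (X (iarr st0 1 (o + j))); rewrite /= ?ltxx.
all: rewrite ?a1 ?a2 ?b1 ?b2 ?c1 ?c2 ?c3 ?d1 ?d2 ?e1 ?e2 ?addr0 -?addnA ?addn1 ?addnS.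
all: by split.
Qed.

Lemma u_le k l : (k <= l < M)%N ->
  K (iarr st0 1 (o + k)) <= K (iarr st0 1 (o + l)).
Proof.
move=> /andP[kl lM]; have kM := leq_ltn_trans kl lM.
rewrite -!keyE -!nth_u //.
apply: (sorted_leq_nth _ _ _ u_sorted) => //.
by move=> y x z; exact: le_trans.
Qed.

(** A premise of the result alone, so that halting and running time also hold for graphs without
    edges, where [D = 0]. *)
Definition centred_spectrum : Prop :=
  [/\ forall F : R -> R, \sum_(x <- lam) F x = \sum_(i <- u) F (X i) *+ c i,
      0 < D, \sum_(x <- lam) x = 0,
      \sum_(x <- lam) x ^+ 2 = (size lam)%:R * D & (0 < size lam)%N].

(** The current group starts at [g] and [j] items have been read. A nonempty open group shares its
    key with item [j], the next one; at the end of the list every group is closed. *)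
Definition sweep_inv (k : nat) st : Prop :=
  exists g j, [/\ (j + k)%N = M, (g <= j)%N, sweep_at g j st,
   [/\ {in take g u & drop g u, forall i i', K i < K i'},
      (j < M)%N -> {in drop g (take j u), forall i, K i = K (iarr st0 1 (o + j))} &
      j = M -> g = M] &
   centred_spectrum -> best_upto lam D X u g (rvar st 0)].

Lemma mem_drop_nth g j : (g <= j < M)%N -> iarr st0 1 (o + j) \in drop g u.
Proof.
move=> /andP[gj jM]; rewrite -nth_u // -(subnKC gj) -nth_drop.
by apply: mem_nth; rewrite size_drop ltn_sub2r // (leq_ltn_trans gj).
Qed.

Lemma sweep_step_inv k st : sweep_inv k.+1 st -> sweep_inv k (sem sweep_step st).
Proof.
move=> [g [j [jk gj sw [g1 g2 g3] gd]]].
have jM : (j < M)%N by lia.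
have [sw1 r1] := sem_add_item jM sw.
rewrite /sweep_step; set cond := If _ _ _.
change (sem (Seq _ _) st) with (sem cond (sem (incr vi) (sem add_item st))).
move: sw1 r1; set st1 := sem (incr vi) _ => sw1 r1.
have grp : {in drop g (take j.+1 u), forall i, K i = K (iarr st0 1 (o + j))}.
  move=> i; rewrite (take_nth 0%N) // drop_rcons ?size_take ?jM //.
  by rewrite mem_rcons inE nth_u // => /orP[/eqP ->|/(g2 jM)].
have [[i1 e1] [ia ra] _ _ _] := sw1.
(* The index has already advanced to [o + j.+1], so [vi - 1] refers to the item just read. *)
have condE : beval st1 (BAnd (ltv vi ve)
      (BNot (BLtR (RArr 1 (IArr 1 (ISub (IVar vi) (INum 1)))) (key vi)))) =
    (j.+1 < M)%N && (K (iarr st0 1 (o + j.+1)) <= K (iarr st0 1 (o + j))).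
  cbn [beval ieval reval ltv key]; rewrite i1 e1 ia ra !keyE -leNgt ltn_add2l.
  by rewrite addnS subn1.
rewrite /cond; cbn [sem]; rewrite condE; case: ifPn => [/andP[jM1 kj]|hc].
  exists g, j.+1; split=> //; first by lia.
  - by lia.
  - split=> //; last by lia.
    move=> _ i /grp ->; apply/eqP; rewrite eq_le kj u_le //.
    by rewrite leqnSn jM1.
  - by rewrite r1.
set s2 := sem eval_cut st1.
have [sw2 r2] := sem_eval_cut sw1.
set s3 := sem (Seq (SetRVar rposl (RVar rposr)) (SetRVar rnegl (RVar rnegr))) s2.
have sw3 : sweep_at j.+1 j.+1 s3.
  by move: sw2; rewrite -/s2; case=> [A B C _ [E1 E2]]; rewrite /sweep_at /= E1 E2.
have [sw4 r4] := sem_eval_cut sw3.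
change (sem close_group st1) with (sem eval_cut s3).
have above : {in drop j.+1 u, forall i, K (iarr st0 1 (o + j)) < K i}.
  move=> i /(nthP 0%N)[l]; rewrite size_drop nth_drop => hl <-.
  have hl' : (j.+1 + l < M)%N by rewrite -ltn_subRL.
  rewrite nth_u //; apply: lt_le_trans (u_le (k := j.+1) _); last by rewrite hl' leq_addr.
  by move: hc; rewrite (leq_ltn_trans (leq_addr l _) hl') /= -ltNge.
have below : {in take g u, forall i, K i < K (iarr st0 1 (o + j))}.
  by move=> i hi; apply: g1 => //; apply: mem_drop_nth; rewrite gj.
exists j.+1, j.+1; split=> //; first by lia.
- split=> // [i i' hi /above|]; last first.
    move=> jM1 i; rewrite drop_oversize // size_take; case: ifP => //; lia.
  apply: le_lt_trans; move: hi.
  rewrite -{1}(cat_take_drop g (take j.+1 u)) take_takel; last by lia.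
  by rewrite mem_cat => /orP[/below/ltW|/grp ->].
- move=> h; have [h1 h2 h3 h4 h5] := h; rewrite r4 /= -/s2 r2 r1.
  apply: (best_upto_step h1 h2 h3 h4 _ below grp above (gd h)); by lia.
Qed.

Definition sweep_time : nat := (200 + (M * (400 + 3).+1 + 4))%N.

Lemma runs_sweep : o = ivar st0 vo -> ivar st0 vM = M ->
  [/\ rvar st0 rpos = \sum_(i <- u) posw X c i,
      rvar st0 rneg = \sum_(i <- u) negw X c i &
      rvar st0 rzero = \sum_(i <- u) zerow X c i] ->
  [/\ rvar st0 rposl = 0, rvar st0 rnegl = 0, rvar st0 rposr = 0 & rvar st0 rnegr = 0] ->
  runs sweep st0 sweep_time (fun st => centred_spectrum -> is_nu 2 lam (rvar st 0)).
Proof.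
move=> hoE hM [p1 p2 p3] [z1 z2 z3 z4].
apply: runs_seq; apply: runs_sem => //.
set init := Seq (SetRVar _ _) _.
change (sem (Seq init eval_cut) st0) with (sem eval_cut (sem init st0)).
have sw1 : sweep_at 0 0 (sem init st0).
  have w0 (w : nat -> R) : weight u w 0 = 0 by rewrite /weight take0 big_nil.
  by rewrite /sweep_at /= !w0 z1 z2 z3 z4 hM -hoE addn0.
have [sw2 r2] := sem_eval_cut sw1.
apply: (runs_while (I := sweep_inv)).
- exists 0%N, 0%N; split=> //.
    by split=> //; rewrite ?take0.
  move=> [h1 h2 h3 h4 h5]; rewrite r2; exact: best_upto0.
- move=> [|k] st' I' hb.
    case: I' => g [j [jk _ [[a1 a2] _ _ _ _] _ _]].
    by move: hb; rewrite /= a1 a2 -jk addn0 ltnn.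
  exists k => //; apply: runs_sem => //; exact: sweep_step_inv.
- move=> k st' [g [j [jk _ [[a1 a2] _ _ _ _] [_ _ gM] gd]]] hb h.
  have jM : j = M by move: hb; rewrite /= a1 a2; lia.
  have [h1 h2 h3 h4 h5] := h.
  move: (gd h); rewrite (gM jM); exact: best_upto_is_nu.
Qed.

End Sweep.

(** * The program *)

Definition sum_step : cmd :=
  let x := RArr 0 (IVar vk) in
  let c := RNat (IArr 0 (IVar vk)) in
  Seq (add_to rcard c)
 (Seq (add_to rsqr (RMul c (RMul x x)))
 (Seq (If (BLtR (RNat (INum 0)) x) (add_to rpos c)
          (If (BLtR x (RNat (INum 0))) (add_to rneg c) (add_to rzero c)))
      (incr vk))).

Definition key_step : cmd :=
  let x := RArr 0 (IVar vk) in
  Seq (SetRArr 1 (IVar vk) (RSub x (RDiv (RVar rD) x)))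
 (Seq (SetIArr 1 (IVar vk) (IVar vk))
      (incr vk)).

(* Padding needs no initialisation: beyond the input the memory is zero, which
   encodes eigenvalue 0 with multiplicity 0 and key [0 - D / 0 = 0]. *)
Definition prepare : cmd :=
  Seq (While (ltv vk vm) sum_step)
 (Seq (Seq (SetRVar rD (RDiv (RVar rsqr) (RVar rcard))) (SetIVar vM (INum 1)))
 (Seq (While (ltv vM vm) (SetIVar vM (IAdd (IVar vM) (IVar vM))))
 (Seq (SetIVar vk (INum 0))
      (While (ltv vk vM) key_step)))).

Definition nu2_prog : cmd := Seq prepare (Seq merge_sort sweep).

(** * Initialisation, and correctness of the whole program *)

Section Prepare.
Variables (R : realType) (s : seq (R * nat)).
Implicit Types st : state R.
Local Notation m := (size s).
Local Notation X := (nth 0 (unzip1 s)).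
Local Notation c := (nth 0%N (unzip2 s)).
Local Notation L := (up_log 2 m).
Local Notation tot w k := (\sum_(i <- iota 0 k) w i).

Definition card_w (i : nat) : R := (c i)%:R.
Definition sqr_w (i : nat) : R := (c i)%:R * (X i * X i).

Definition mean_sqr : R := tot sqr_w m / tot card_w m.

Definition loaded st : Prop :=
  [/\ ivar st vm = m, ivar st vo = 0%N, iarr st 0 = c, rarr st 0 = X &
      [/\ rvar st rposl = 0, rvar st rnegl = 0, rvar st rposr = 0 & rvar st rnegr = 0]].

Definition totals (k : nat) st : Prop :=
  [/\ rvar st rpos = tot (posw X c) k, rvar st rneg = tot (negw X c) k &
      rvar st rzero = tot (zerow X c) k].

Lemma tot_recr (w : nat -> R) k : tot w k.+1 = tot w k + w k.
Proof. by rewrite -addn1 iotaD big_cat /= big_seq1. Qed.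

Definition sum_inv (k : nat) st : Prop :=
  exists2 r, (r + k)%N = m &
  [/\ loaded st, totals r st, ivar st vk = r, rvar st rcard = tot card_w r /\
      rvar st rsqr = tot sqr_w r & forall i, rarr st 1 i = 0].

Lemma sum_step_inv k st : sum_inv k.+1 st -> sum_inv k (sem sum_step st).
Proof.
move=> [r rk [[a1 a2 a3 a4 [a5 a6 a7 a8]] [b1 b2 b3] d [e1 e2] f]].
exists r.+1; first by rewrite -rk addSnnS.
rewrite /loaded /totals !tot_recr /posw /negw /zerow.
rewrite /= d a3 a4.
have [x0|x0|x0] := ltgtP 0 (X r); rewrite /= ?ltxx.
all: rewrite ?a1 ?a2 ?a3 ?a4 ?a5 ?a6 ?a7 ?a8 ?b1 ?b2 ?b3 ?d ?e1 ?e2 ?addr0 ?addn1.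
all: by [].
Qed.

Definition prep_time : nat :=
  (m * (100 + 3).+1 + 4 + (10 + (L * (4 + 3).+1 + 4 + (2 + (2 ^ L * (30 + 3).+1 + 4)))))%N.

Lemma runs_prepare :
  runs prepare (input s) prep_time (fun st =>
    [/\ loaded st, totals m st, ivar st vM = (2 ^ L)%N,
        forall i, rarr st 1 i = skey mean_sqr (X i) &
        slice (iarr st 1) 0 (2 ^ L) = iota 0 (2 ^ L)]).
Proof.
apply: runs_seq; apply: (runs_while (I := sum_inv)).
- by exists 0%N; rewrite /loaded /totals ?big_nil.
- move=> [|k] st I hb.
    case: I => r rk [[a1 _ _ _ _] _ d _ _].
    by move: hb; rewrite /= a1 d -rk addn0 ltnn.
  by exists k => //; apply: runs_sem => //; exact: sum_step_inv.
move=> k st [r rk [[a1 a2 a3 a4 a5] b d e f]] hb.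
have rm : r = m by move: hb; rewrite /= a1 d; lia.
rewrite {}rm in b d e; clear r rk.
apply: runs_seq; apply: runs_sem => //; set st1 := sem _ st.
pose P st := [/\ loaded st, totals m st, rvar st rD = mean_sqr & forall i, rarr st 1 i = 0].
have P1 : P st1 by case: e => e1 e2; rewrite /P /loaded /totals /= e1 e2.
apply: runs_seq.
(* Doubling from 1 until at least [m] stops exactly at [2 ^ L], by minimality of [up_log]. *)
apply: (runs_while (I := fun k st => exists2 l, (l + k)%N = L &
                           P st /\ ivar st vM = (2 ^ l)%N)).
- by exists 0%N.
- move=> k' st2 [l lk [[[q1 q2 q3 q4 q5] p2 p3 p4] h]] hb'.
  case: k' lk => [|k'] lk.
    move: hb'; rewrite /= h q1 -lk addn0 => hb'.
    have : (m <= 2 ^ L)%N by exact: up_logP.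
    by rewrite -lk addn0 leqNgt hb'.
  exists k' => //; apply: runs_sem => //; exists l.+1; first by rewrite -lk addSnnS.
  by rewrite /P /loaded /totals /= h expnS mul2n addnn.
move=> k' st2 [l lk [p h]] hb'.
have [[q1 q2 q3 q4 q5] p2 p3 p4] := p.
have lL : l = L.
  have : (L <= l)%N by apply: up_log_min => //; move: hb'; rewrite /= h q1; lia.
  by move: lk; lia.
rewrite {}lL {lk} in h.
apply: runs_seq; apply: runs_sem => //; set st3 := sem _ st2.
apply: (runs_while (I := fun k st => exists2 r, (r + k)%N = (2 ^ L)%N &
  [/\ loaded st, totals m st /\ rvar st rD = mean_sqr, ivar st vM = (2 ^ L)%N,
      ivar st vk = r &
      (forall i, rarr st 1 i = if (i < r)%N then skey mean_sqr (X i) else 0) /\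
      (forall i, (i < r)%N -> iarr st 1 i = i)])).
- by exists 0%N.
- move=> k2 st4 [r rk2 [l4 [t4 D4] M4 k4 [ra4 ia4]]] hb4.
  case: k2 rk2 => [|k2] rk2; first by move: hb4; rewrite /= M4 k4 -rk2 addn0 ltnn.
  exists k2 => //; apply: runs_sem => //; exists r.+1; first by rewrite -rk2 addSnnS.
  have [z1 z2 z3 z4 z5] := l4.
  split=> //=; first by rewrite k4 addn1.
  rewrite k4 z4 D4; split=> i.
    rewrite ltnS leq_eqVlt ra4; case: eqP => //= -> //.
  rewrite ltnS leq_eqVlt; case: eqP => [->//|_ /=]; exact: ia4.
- move=> k2 st4 [r rk2 [l4 [t4 D4] M4 k4 [ra4 ia4]]] hb4.
  have rM : r = (2 ^ L)%N by move: hb4; rewrite /= M4 k4; lia.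
  rewrite {}rM in ra4 ia4; split=> //.
    (* Past [2 ^ L] the untouched 0 equals the key of a missing item, as [0 - D / 0 = 0]; hence the
       claim for every index. *)
    move=> i; rewrite ra4; case: ltnP => // hi.
    rewrite /skey nth_default ?invr0 ?mulr0 ?subr0 // size_map.
    by apply: leq_trans hi; exact: up_logP.
  rewrite -[RHS]map_id; apply/eq_in_map => i; rewrite mem_iota add0n => /andP[_].
  exact: ia4.
Qed.

Lemma tot_pad (w : nat -> R) k : (m <= k)%N -> (forall i, c i = 0%N -> w i = 0) ->
  tot w k = tot w m.
Proof.
move=> mk w0; rewrite -(subnKC mk) iotaD big_cat /= [X in _ + X]big_seq.
rewrite [X in _ + X]big1 ?addr0 // => i; rewrite mem_iota add0n => /andP[h _].
by apply: w0; rewrite nth_default // size_map.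
Qed.

Definition total_time : nat :=
  (prep_time + (sort_time L + sweep_time (iota 0 (2 ^ L))))%N.

Lemma runs_nu2_prog (lam : seq R) : perm_eq (tally_seq s) lam ->
  runs nu2_prog (input s) total_time (fun st =>
    \sum_(x <- lam) x = 0 -> 0 < \sum_(x <- lam) x ^+ 2 ->
    is_nu 2 lam (output st)).
Proof.
move=> sl; apply: runs_seq; apply: runs_weaken (leqnn _) _ runs_prepare.
move=> st1 [[a1 a2 a3 a4 [z1 z2 z3 z4]] [b1 b2 b3] M1 K1 T1].
apply: runs_seq.
apply: runs_weaken (leqnn _) _ (runs_merge_sort (K := rarr st1 1) erefl M1).
move=> st2 [so pe [f1 f2 f3 f4]].
set u := slice _ _ _ in so pe.
have su : size u = (2 ^ L)%N by rewrite size_slice.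
have pu : perm_eq u (iota 0 (2 ^ L)) by move: pe; rewrite a2 T1.
have mL : (m <= 2 ^ L)%N by exact: up_logP.
have sumu (w : nat -> R) : (forall i, c i = 0%N -> w i = 0) ->
    \sum_(i <- u) w i = tot w m.
  by move=> h; rewrite (perm_big _ pu) /= tot_pad.
have X2 : rarr st2 0 = X by rewrite f2.
have c2 : iarr st2 0 = c by rewrite f3.
have -> : sweep_time (iota 0 (2 ^ L)) = sweep_time u.
  by rewrite /sweep_time size_iota su.
have := @runs_sweep R lam mean_sqr u (ivar st2 vo) st2.
rewrite X2 c2 f1 f2 su -/u => /(_ K1 erefl so erefl).
rewrite (f4 vM) // M1 b1 b2 b3 z1 z2 z3 z4 !sumu; first last.
- by move=> i h; rewrite /posw h; case: ifP.
- by move=> i h; rewrite /negw h; case: ifP.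
- by move=> i h; rewrite /zerow h; case: ifP.
move=> /(_ erefl) H.
apply: runs_weaken (leqnn _) _ (H _ _) => // st3 H3 S1 S2; apply: H3.
have lamu (F : R -> R) : \sum_(x <- lam) F x = \sum_(i <- u) F (X i) *+ c i.
  by rewrite (big_tally F sl mL) (perm_big _ pu).
have sz : (size lam)%:R = tot card_w m.
  have -> : (size lam)%:R = \sum_(x <- lam) (1 : R).
    by rewrite big_const_seq count_predT iter_addr_0.
  by rewrite (big_tally _ sl (leqnn _)).
have sq : \sum_(x <- lam) x ^+ 2 = tot sqr_w m.
  rewrite (big_tally _ sl (leqnn _)); apply: eq_bigr => i _.
  by rewrite /sqr_w mulr_natl expr2.
have lam0 : (0 < size lam)%N.
  by rewrite lt0n; apply/negP => /eqP/size0nil l0; move: S2; rewrite l0 big_nil ltxx.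
have n0 : 0 < tot card_w m by rewrite -sz ltr0n.
rewrite /centred_spectrum X2 c2 /mean_sqr -sq -sz in n0 *; split=> //.
- by rewrite divr_gt0.
- by rewrite mulrC divfK ?gt_eqF.
Qed.
End Prepare.

(** * The bound of order n log n *)

Section Time.
Variables (R : realType) (s : seq (R * nat)).

(** Padding gives at most [2 * n] items, and [L <= l + 1 <= 2 * l], so the dominant term [L * 2 ^ L]
    is at most [4 * (n * l)]. The remaining terms are linear in [n] or [L], or constant. *)
Lemma total_time_le n : (1 < n)%N -> (size s <= n)%N ->
  (total_time s <= 4000 * (n * trunc_log 2 n))%N.
Proof.
move=> n1 mn; set l := trunc_log 2 n; set L := up_log 2 (size s).
have l0 : (0 < l)%N by rewrite trunc_log_gt0.
have Ll : (L <= l.+1)%N.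
  apply: leq_trans (leq_up_log 2 mn) _; rewrite up_log_trunc_log // ltnS.
  exact/leq_trunc_log/leq_pred.
have ML : (2 ^ L <= 2 * n)%N.
  have [m1|m1] := leqP (size s) 1.
    have -> : L = 0%N by apply/eqP; rewrite up_log_eq0 m1 orbT.
    by rewrite expn0; lia.
  (* Minimality of [L] gives [2 ^ (L - 1) < size s]. *)
  have := up_log_gtn (isT : (1 < 2)%N) m1; rewrite -/L => h.
  have L0 : (0 < L)%N by rewrite up_log_gt0.
  by rewrite -(prednK L0) expnS; lia.
rewrite /total_time /prep_time /sort_time /sweep_time size_iota -/L.
move: (2 ^ L)%N ML => M ML.
have LM : (L * M <= 4 * (n * l))%N.
  by apply: leq_trans (leq_mul Ll ML) _; nia.
have nl : (n <= n * l)%N by rewrite leq_pmulr.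
have ll : (l <= n * l)%N by rewrite leq_pmull //; lia.
have -> : (L * (100 * M + 24 + 3).+1 = 100 * (L * M) + 28 * L)%N by ring.
by lia.
Qed.

End Time.

(** A well-formed tally has no multiplicity 0, so each pair accounts for at least one entry. *)
Lemma wf_tally_size (T : eqType) (s : seq (T * nat)) :
  s \is a wf_tally T -> (size s <= size (tally_seq s))%N.
Proof.
case/andP=> _; rewrite size_tally_seq.
have <- : size (unzip2 s) = size s by rewrite size_map.
elim: (unzip2 s) => //= n l IH; rewrite inE negb_or => /andP[n0 /IH h].
by rewrite -add1n leq_add // lt0n eq_sym.
Qed.

(** * Eigenvalues of the adjacency matrix *)

Section Spectrum.
Variable R : realType.

(** A diagonal entry of [B *m B^T] is the sum of the squares of a row of [B]. *)
Lemma sym_sqr_eq0 n (B : 'M[R]_n) : B^T = B -> B *m B = 0 -> B = 0.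
Proof.
move=> Bs B2; apply/matrixP => i j; rewrite mxE.
have : (B *m B^T) i i = 0 by rewrite Bs B2 mxE.
rewrite mxE => /eqP; rewrite psumr_eq0; last by move=> k _; rewrite mxE -expr2 sqr_ge0.
by move=> /allP/(_ j); rewrite mem_index_enum mxE mulf_eq0 orbb => /(_ isT)/eqP.
Qed.

(** The exponent is raised to [2 ^ k] and then halved repeatedly, each power of [B] being
    symmetric. *)
Lemma sym_nilpotent n (B : 'M[R]_n.+1) k : B^T = B -> B ^+ k = 0 -> B = 0.
Proof.
move=> Bs Bk; have : B ^+ (2 ^ k) = 0.
  by rewrite -(subnK (ltnW (ltn_expl k (isT : (1 < 2)%N)))) exprD Bk mulr0.
elim: (k) => [|j IH]; first by rewrite expr1.
rewrite expnS mulnC exprM expr2 => h; apply: IH; apply: sym_sqr_eq0 h.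
elim: (2 ^ j)%N => [|i IHi]; first by rewrite expr0 trmx1.
by rewrite {1}exprS -[_ * _]/(_ *m _) trmx_mul IHi Bs exprSr.
Qed.

Lemma char_poly_Xn n (B : 'M[R]_n) :
  B^T = B -> char_poly B = 'X^n -> B = 0.
Proof.
case: n B => [|n] B Bs Bc; first by apply/matrixP => -[].
have := Cayley_Hamilton B; rewrite Bc rmorphXn /= horner_mx_X.
exact: sym_nilpotent.
Qed.

Variables (T : finType) (e : rel T).
Hypotheses (e_sym : symmetric e) (e_irr : irreflexive e).
Variable lam : #|T|.-tuple R.
Hypothesis lamP : adj_eigenvalues e lam.

(** The sum is the trace, which vanishes as there are no loops. The empty graph is separate because
    the trace is read off the coefficient of degree [#|T| - 1]. *)
Lemma sum_eigenvalues : \sum_(x <- lam) x = 0.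
Proof.
have [T0|T0] := posnP #|T|.
  have -> : lam = [::] :> seq R by apply: size0nil; rewrite size_tuple.
  by rewrite big_nil.
have [_ cp] := lamP; have := char_poly_trace (adjmx R e) T0.
have := @coefPn_prod_XsubC R lam; rewrite size_tuple -cp -lt0n => /(_ T0) -> /oppr_inj ->.
by rewrite /mxtrace big1 // => i _; rewrite mxE e_irr.
Qed.

(** If all eigenvalues were 0, the characteristic polynomial would be a power of ['X] and the
    adjacency matrix would be zero. *)
Lemma sum_sqr_eigenvalues : (exists x y, e x y) -> 0 < \sum_(x <- lam) x ^+ 2.
Proof.
move=> [x [y exy]]; rewrite lt0r sumr_ge0 ?andbT; last by move=> *; exact: sqr_ge0.
rewrite psumr_eq0; last by move=> *; exact: sqr_ge0.
apply/negP => /allP lam0.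
have A0 : adjmx R e = 0.
  apply: char_poly_Xn; first by apply/matrixP => i j; rewrite !mxE e_sym.
  have [_ ->] := lamP; rewrite big_seq (eq_bigr (fun=> 'X)); last first.
    by move=> z /lam0; rewrite sqrf_eq0 => /eqP ->; rewrite subr0.
  by rewrite -big_seq big_const_seq count_predT size_tuple iter_mulr_1.
have := congr1 (fun A : 'M_ _ => A (enum_rank x) (enum_rank y)) A0.
by rewrite !mxE !enum_rankK exy => /eqP; rewrite oner_eq0.
Qed.

End Spectrum.

(** Program and constant are fixed before the graph. Without edges every eigenvalue is 0, no
    polynomial is admissible and the maximum does not exist, hence the premise on the output. The
    time bound starts at two vertices because [trunc_log 2 1 = 0]. *)
Theorem theorem4p9 (R : realType) :
  exists (prog : cmd) (C : nat),
  forall (T : finType) (e : rel T) (lam : #|T|.-tuple R) (s : seq (R * nat)),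
    symmetric e -> irreflexive e ->
    partially_walk_regular R e 2 ->
    adj_eigenvalues e lam ->
    s \is a wf_tally R -> perm_eq (tally_seq s) lam ->
    exists (st : state R) (t : nat),
      [/\ exec prog (input s) st t,
          (1 < #|T|)%N -> (t <= C * (#|T| * trunc_log 2 #|T|))%N
        & (exists x y : T, e x y) -> is_nu 2 lam (output st)].
Proof.
exists nu2_prog, 4000%N => T e lam s e_sym e_irr _ lamP s_wf sl.
have [st [t [E ht nu]]] := runs_nu2_prog sl.
exists st, t; split=> // [T1|edge].
  apply: leq_trans ht (total_time_le T1 _).
  by apply: leq_trans (wf_tally_size s_wf) _; rewrite (perm_size sl) size_tuple.
by apply: nu; [exact: sum_eigenvalues lamP | exact: sum_sqr_eigenvalues lamP edge].
Qed.
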